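(* There are no Einstein weak $f$-K-contact manifolds $M^{2n+s}(f,Q,\xi_i,\eta^i,g)$ with $s>1$.
   Context: Let $n,s\ge1$ and let $M=M^{2n+s}$ be a smooth manifold of dimension $2n+s$. A weak metric $f$-structure on $M$ is a set $(f,Q,\xi_i,\eta^i,g)$ $(i=1,\dots,s)$, where $f$ is a $(1,1)$-tensor, $Q$ is a nonsingular $(1,1)$-tensor, $\xi_i$ are vector fields (the characteristic vector fields), $\eta^i$ are 1-forms and $g$ is a Riemannian metric, such that $$f^2=-Q+\sum_i\eta^i\otimes\xi_i,\quad \eta^i(\xi_j)=\delta^i_j,\quad Q\,\xi_i=\xi_i,$$ the $2n$-dimensional distribution $\mathcal D:=\bigcap_i\ker\eta^i$ is $f$-invariant ($fX\in\mathcal D$ for $X\in\mathcal D$), and $g(fX,fY)=g(X,QY)-\sum_i\eta^i(X)\,\eta^i(Y)$ for all vector fields $X,Y$. Put $\Phi(X,Y)=g(X,fY)$. The exterior derivative of a 1-form is normalized by $d\eta(X,Y)=\frac12\{X(\eta(Y))-Y(\eta(X))-\eta([X,Y])\}$. The structure is weak $f$-contact if $\Phi=d\eta^1=\dots=d\eta^s$; a weak $f$-contact structure is weak $f$-K-contact if all $\xi_i$ are Killing for $g$. Einstein means $\operatorname{Ric}=\lambda g$ with $\lambda\in\mathbb R$ constant. *)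

(* Defs.v *)
From HB Require Import structures.
From mathcomp Require Import all_boot all_order all_algebra.
From mathcomp Require Import all_classical all_reals all_analysis.

Set Implicit Arguments.
Unset Strict Implicit.
Unset Printing Implicit Defensive.

Import Order.TTheory GRing.Theory Num.Theory numFieldNormedType.Exports.

Local Open Scope classical_set_scope.
Local Open Scope ring_scope.

(* Points of R^m and tangent vectors are rows, so a linear map acts by       *)
(* u |-> u *m A; covectors are columns; a bilinear form with matrix G is      *)
(* (u, v) |-> u *m G *m v^T.                                                  *)

Definition partial (R : realType) (m : nat) (i : 'I_m) (h : 'rV[R]_m -> R)
    (x : 'rV[R]_m) : R := 'D_(delta_mx 0 i : 'rV[R]_m) h x.

(* Class C^k on an open set U, by means of iterated partial derivatives. *)
Fixpoint class_C (R : realType) (m k : nat) (U : set 'rV[R]_m)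
    (h : 'rV[R]_m -> R) {struct k} : Prop :=
  (forall x, U x -> {for x, continuous h}) /\
  match k with
  | 0 => True
  | k'.+1 => forall i : 'I_m,
      (forall x, U x -> derivable h x (delta_mx 0 i : 'rV[R]_m)) /\
      class_C k' U (partial i h)
  end.

Definition smooth (R : realType) (m : nat) (U : set 'rV[R]_m)
  (h : 'rV[R]_m -> R) : Prop := forall k, class_C k U h.

Definition smooth_mx (R : realType) (m p q : nat) (U : set 'rV[R]_m)
  (A : 'rV[R]_m -> 'M[R]_(p, q)) : Prop :=
  forall i j, smooth U (fun x => A x i j).

(* J i j is the derivative of the j-th component in the direction i, so that *)
(* the differential at x is u |-> u *m J.                                    *)
Definition jacobian_mx (R : realType) (m : nat) (phi : 'rV[R]_m -> 'rV[R]_m)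
    (x : 'rV[R]_m) : 'M[R]_m :=
  \matrix_(i, j) partial i (fun y => phi y 0 j) x.

(** * Smooth manifolds *)

(* The values of the two maps outside chart_dom and its image are junk. *)
Record chart (R : realType) (m : nat) (M : topologicalType) := Chart {
  chart_dom : set M;
  chart_map : M -> 'rV[R]_m;
  chart_inv : 'rV[R]_m -> M;
  chart_dom_open : open chart_dom;
  chart_img_open : open (chart_map @` chart_dom);
  chart_mapK : forall p, chart_dom p -> chart_inv (chart_map p) = p;
  chart_map_cont : forall p, chart_dom p -> {for p, continuous chart_map};
  chart_inv_cont :
    forall x, (chart_map @` chart_dom) x -> {for x, continuous chart_inv} }.

Definition chart_img (R : realType) (m : nat) (M : topologicalType)
  (c : chart R m M) : set 'rV[R]_m := chart_map c @` chart_dom c.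

Definition overlap (R : realType) (m : nat) (M : topologicalType)
  (c d : chart R m M) : set 'rV[R]_m :=
  chart_map c @` (chart_dom c `&` chart_dom d).

Definition transition (R : realType) (m : nat) (M : topologicalType)
  (c d : chart R m M) (x : 'rV[R]_m) : 'rV[R]_m :=
  chart_map d (chart_inv c x).

(* Manifolds are nonempty (the empty space would carry every structure), but  *)
(* need not be connected.                                                     *)
Record smooth_manifold (R : realType) (m : nat) := SmoothManifold {
  carrier :> topologicalType;
  index : Type;
  atlas : index -> chart R m carrier;
  manifold_nonempty : [set: carrier] !=set0;
  manifold_hausdorff : hausdorff_space carrier;
  manifold_second_countable : @second_countable carrier;
  atlas_cover : forall p : carrier, exists a, chart_dom (atlas a) p;
  atlas_compatible : forall a b,
    smooth_mx (overlap (atlas a) (atlas b)) (transition (atlas a) (atlas b)) }.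

Definition img (R : realType) (m : nat) (M : smooth_manifold R m)
  (a : index M) : set 'rV[R]_m := chart_img (atlas a).

(** * Tensor fields *)

(* A tensor field is given by its components in every chart of the atlas, as  *)
(* functions of the coordinates, subject to the transformation law of its     *)
(* type.                                                                      *)

Definition smooth_components (R : realType) (m p q : nat)
  (M : smooth_manifold R m) (A : index M -> 'rV[R]_m -> 'M[R]_(p, q)) : Prop :=
  forall a, smooth_mx (img a) (A a).

(* [L J T T'] is to relate the components T and T' of the same tensor in two  *)
(* charts, J being the Jacobian matrix of the change of coordinates.          *)
Definition transforms (R : realType) (m p q : nat) (M : smooth_manifold R m)
  (L : 'M[R]_m -> 'M[R]_(p, q) -> 'M[R]_(p, q) -> Prop)
  (A : index M -> 'rV[R]_m -> 'M[R]_(p, q)) : Prop :=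
  forall a b x, overlap (atlas a) (atlas b) x ->
    let tau := transition (atlas a) (atlas b) in
    L (jacobian_mx tau x) (A a x) (A b (tau x)).

Record vector_field (R : realType) (m : nat) (M : smooth_manifold R m) :=
  VectorField {
    vf_comp :> index M -> 'rV[R]_m -> 'M[R]_(1, m);
    vf_smooth : smooth_components vf_comp;
    vf_law : transforms (fun J X X' => X' = X *m J) vf_comp }.

Record one_form (R : realType) (m : nat) (M : smooth_manifold R m) :=
  OneForm {
    of_comp :> index M -> 'rV[R]_m -> 'M[R]_(m, 1);
    of_smooth : smooth_components of_comp;
    of_law : transforms (fun J w w' => w = J *m w') of_comp }.

Record endo_field (R : realType) (m : nat) (M : smooth_manifold R m) :=
  EndoField {
    ef_comp :> index M -> 'rV[R]_m -> 'M[R]_(m, m);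
    ef_smooth : smooth_components ef_comp;
    ef_law : transforms (fun J A A' => A *m J = J *m A') ef_comp }.

Definition form_app (R : realType) (m : nat) (w : 'cV[R]_m) (u : 'rV[R]_m) : R
  := (u *m w) 0 0.

Definition bilin (R : realType) (m : nat) (G : 'M[R]_m) (u v : 'rV[R]_m) : R
  := (u *m G *m v^T) 0 0.

Record riemannian_metric (R : realType) (m : nat) (M : smooth_manifold R m) :=
  RiemannianMetric {
    rm_comp :> index M -> 'rV[R]_m -> 'M[R]_(m, m);
    rm_smooth : smooth_components rm_comp;
    rm_law : transforms (fun J G G' => G = J *m G' *m J^T) rm_comp;
    rm_sym : forall a x, img a x ->
      forall u v, bilin (rm_comp a x) u v = bilin (rm_comp a x) v u;
    rm_pos : forall a x, img a x ->
      forall u, u != 0 -> 0 < bilin (rm_comp a x) u u }.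

(** * Calculus in a chart *)

(* X, Y, Z below are coordinate expressions of vector fields on the domain of *)
(* a chart, and G, eta those of a metric and of a 1-form.                     *)

Definition dirder (R : realType) (m : nat) (X : 'rV[R]_m -> 'rV[R]_m)
  (h : 'rV[R]_m -> R) (x : 'rV[R]_m) : R :=
  \sum_(i < m) X x 0 i * partial i h x.

Definition bracket (R : realType) (m : nat) (X Y : 'rV[R]_m -> 'rV[R]_m)
  (x : 'rV[R]_m) : 'rV[R]_m :=
  \row_k (dirder X (fun y => Y y 0 k) x - dirder Y (fun y => X y 0 k) x).

Definition ext_der (R : realType) (m : nat) (eta : 'rV[R]_m -> 'cV[R]_m)
  (X Y : 'rV[R]_m -> 'rV[R]_m) (x : 'rV[R]_m) : R :=
  2^-1 * (dirder X (fun y => form_app (eta y) (Y y)) x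
          - dirder Y (fun y => form_app (eta y) (X y)) x
          - form_app (eta x) (bracket X Y x)).

Definition lie_metric (R : realType) (m : nat) (xi : 'rV[R]_m -> 'rV[R]_m)
  (G : 'rV[R]_m -> 'M[R]_m) (X Y : 'rV[R]_m -> 'rV[R]_m) (x : 'rV[R]_m) : R :=
  dirder xi (fun y => bilin (G y) (X y) (Y y)) x
  - bilin (G x) (bracket xi X x) (Y x) - bilin (G x) (X x) (bracket xi Y x).

(* The Christoffel symbol Gamma^k_{ij}. *)
Definition christoffel (R : realType) (m : nat) (G : 'rV[R]_m -> 'M[R]_m)
  (k i j : 'I_m) (x : 'rV[R]_m) : R :=
  2^-1 * \sum_(l < m) invmx (G x) k l *
    (partial i (fun y => G y j l) x + partial j (fun y => G y i l) x
     - partial l (fun y => G y i j) x).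

(* The Levi-Civita derivative of Y in the direction X. *)
Definition nabla (R : realType) (m : nat) (G : 'rV[R]_m -> 'M[R]_m)
  (X Y : 'rV[R]_m -> 'rV[R]_m) (x : 'rV[R]_m) : 'rV[R]_m :=
  \row_k (dirder X (fun y => Y y 0 k) x
          + \sum_(i < m) \sum_(j < m) christoffel G k i j x * X x 0 i * Y x 0 j).

Definition curvature (R : realType) (m : nat) (G : 'rV[R]_m -> 'M[R]_m)
  (X Y Z : 'rV[R]_m -> 'rV[R]_m) (x : 'rV[R]_m) : 'rV[R]_m :=
  nabla G X (nabla G Y Z) x - nabla G Y (nabla G X Z) x
  - nabla G (bracket X Y) Z x.

(* Ric(Y, Z) is the trace of X |-> R(X, Y)Z. *)
Definition ricci (R : realType) (m : nat) (G : 'rV[R]_m -> 'M[R]_m)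
  (Y Z : 'rV[R]_m -> 'rV[R]_m) (x : 'rV[R]_m) : R :=
  \sum_(i < m) curvature G (fun=> delta_mx 0 i) Y Z x 0 i.

(* Identities between tensor fields that involve derivatives are tested on    *)
(* all smooth vector fields on the domains of the charts of the atlas.        *)

Definition killing (R : realType) (m : nat) (M : smooth_manifold R m)
  (g : riemannian_metric M) (xi : vector_field M) : Prop :=
  forall (a : index M) (X Y : 'rV[R]_m -> 'rV[R]_m),
    smooth_mx (img a) X -> smooth_mx (img a) Y ->
    forall x, img a x -> lie_metric (xi a) (g a) X Y x = 0.

Definition einstein (R : realType) (m : nat) (M : smooth_manifold R m)
  (g : riemannian_metric M) : Prop :=
  exists lambda : R,
    forall (a : index M) (X Y : 'rV[R]_m -> 'rV[R]_m),
      smooth_mx (img a) X -> smooth_mx (img a) Y ->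
      forall x, img a x -> ricci (g a) X Y x = lambda * bilin (g a x) (X x) (Y x).

(** * Weak metric f-structures *)

(* The matrix of eta ⊗ xi : u |-> eta(u) xi is eta *m xi. *)
Record weak_metric_f_structure (R : realType) (n s : nat)
    (M : smooth_manifold R (2 * n + s)) := WeakMetricFStructure {
  wf : endo_field M;
  wQ : endo_field M;
  wxi : 'I_s -> vector_field M;
  weta : 'I_s -> one_form M;
  wg : riemannian_metric M;
  wQ_nonsingular : forall a x, img a x -> wQ a x \in unitmx;
  wf_square : forall a x, img a x ->
    wf a x *m wf a x = - wQ a x + \sum_(i < s) weta i a x *m wxi i a x;
  weta_xi : forall a x, img a x ->
    forall i j, form_app (weta i a x) (wxi j a x) = (i == j)%:R;
  wQ_xi : forall a x, img a x -> forall i, wxi i a x *m wQ a x = wxi i a x;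
  wf_invariant : forall a x, img a x -> forall u : 'rV[R]_(2 * n + s),
    (forall i, form_app (weta i a x) u = 0) ->
    forall i, form_app (weta i a x) (u *m wf a x) = 0;
  wg_compatible : forall a x, img a x -> forall u v : 'rV[R]_(2 * n + s),
    bilin (wg a x) (u *m wf a x) (v *m wf a x) =
      bilin (wg a x) u (v *m wQ a x)
      - \sum_(i < s) form_app (weta i a x) u * form_app (weta i a x) v }.

Definition fundamental_form (R : realType) (n s : nat)
  (M : smooth_manifold R (2 * n + s)) (S : weak_metric_f_structure M)
  (a : index M) (X Y : 'rV[R]_(2 * n + s) -> 'rV[R]_(2 * n + s))
  (x : 'rV[R]_(2 * n + s)) : R :=
  bilin (wg S a x) (X x) (Y x *m wf S a x).

Definition weak_f_contact (R : realType) (n s : nat)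
  (M : smooth_manifold R (2 * n + s)) (S : weak_metric_f_structure M) : Prop :=
  forall (i : 'I_s) (a : index M)
    (X Y : 'rV[R]_(2 * n + s) -> 'rV[R]_(2 * n + s)),
    smooth_mx (img a) X -> smooth_mx (img a) Y ->
    forall x, img a x -> fundamental_form S a X Y x = ext_der (weta S i a) X Y x.

Definition weak_f_K_contact (R : realType) (n s : nat)
  (M : smooth_manifold R (2 * n + s)) (S : weak_metric_f_structure M) : Prop :=
  weak_f_contact S /\ forall i : 'I_s, killing (wg S) (wxi S i).

(* Main.v *)
(* On a weak f-K-contact manifold f is skew, hence f xi_i = 0, eta^i = g(., xi_i)
   and the xi_i are orthonormal; by the Koszul formula, the Killing equation and
   d eta^i = Phi give nabla_X xi_i = - f X for every i. So R(X, Y) xi_i does not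
   depend on i, and the Einstein condition yields
   lambda = Ric(xi_1, xi_1) = Ric(xi_1, xi_2) = lambda g(xi_1, xi_2) = 0.
   On the other hand Ric(xi_1, xi_1) = - tr(f^2), because tr(nabla_xi f) = xi(tr f) = 0.
   Hence the skew endomorphism f vanishes, and the nonsingular Q = sum eta^i (x) xi_i
   has rank at most s < 2n + s. *)
Require Import Defs.
From mathcomp Require Import all_boot all_order all_algebra.
From mathcomp Require Import all_classical all_reals all_analysis.
From mathcomp Require Import ring lra.

Set Implicit Arguments.
Unset Strict Implicit.
Unset Printing Implicit Defensive.

Import Order.TTheory GRing.Theory Num.Theory numFieldNormedType.Exports.

Local Open Scope classical_set_scope.
Local Open Scope ring_scope.

(** * Linear algebra of positive definite forms and skew endomorphisms *)

Lemma bilin_delta (R : realType) m (G : 'M[R]_m) (i j : 'I_m) :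
  bilin G (delta_mx 0 i) (delta_mx 0 j) = G i j.
Proof. by rewrite /bilin -rowE trmx_delta -colE !mxE. Qed.

Lemma bilin_deltar (R : realType) m (G : 'M[R]_m) (u : 'rV[R]_m) (j : 'I_m) :
  bilin G u (delta_mx 0 j) = (u *m G) 0 j.
Proof. by rewrite /bilin trmx_delta -colE !mxE. Qed.

Lemma posdef_unitmx (R : realType) m (G : 'M[R]_m) :
  (forall u : 'rV_m, u != 0 -> 0 < bilin G u u) -> G \in unitmx.
Proof.
move=> Gpos; rewrite -row_free_unit; apply: inj_row_free => v vG0.
by apply/eqP/negP => /negP/Gpos; rewrite /bilin vG0 mul0mx mxE ltxx.
Qed.

(** Induction on the size: the Schur complement of the upper left entry is again symmetric and
    positive definite. The rows of [invmx B] then form a frame orthonormal for [G]. *)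
Lemma cholesky (R : realType) m (G : 'M[R]_m) : G^T = G ->
  (forall u : 'rV_m, u != 0 -> 0 < bilin G u u) -> exists B : 'M[R]_m, G = B *m B^T.
Proof.
elim: m G => [|m IHm] G Gsym Gpos; first by exists 0; apply/matrixP => -[].
pose a := G 0 0; pose b : 'rV_m := @ursubmx _ 1 m 1 m G.
pose C : 'M[R]_m := @drsubmx _ 1 m 1 m G.
have GE : G = @block_mx R 1 m 1 m a%:M b b^T C.
  rewrite -[LHS](@submxK _ 1 m 1 m).
  have -> : @dlsubmx _ 1 m 1 m G = b^T by rewrite /b trmx_ursub Gsym.
  suff -> : @ulsubmx _ 1 m 1 m G = a%:M by [].
  by rewrite [LHS]mx11_scalar !mxE !lshift0.
have Csym : C^T = C by rewrite /C trmx_drsub Gsym.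
have a_gt0 : 0 < a.
  rewrite /a -bilin_delta; apply: Gpos; apply/eqP => /matrixP/(_ 0 0)/eqP.
  by rewrite !mxE !eqxx oner_eq0.
pose S := C - a^-1 *: (b^T *m b).
have [||B SE] := IHm S.
- by rewrite /S linearB linearZ /= trmx_mul trmxK Csym.
(* Completing the square: this first coordinate minimises the form among the vectors ending in [v],
   and the minimum is [bilin S v v]. *)
- move=> v v0; pose u : 'rV_(1 + m) := row_mx (- a^-1 *: (v *m b^T)) v.
  have := Gpos u; have -> : bilin G u u = bilin S v v.
    rewrite /bilin GE /u (@tr_row_mx _ 1 1 m) (@mul_row_block _ 1 1 m 1 m).
    rewrite (@mul_row_col _ 1 1 m 1) /S.
    congr (fun_of_matrix _ 0 0).
    rewrite mul_mx_scalar scalerA mulrN divff ?gt_eqF// scaleN1r addNr mul0mx add0r.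
    by rewrite -scalemxAl mulmxBr -scalemxAr -mulmxA scaleNr addrC !mulmxA.
  apply; apply: contra v0 => /eqP/(congr1 (@rsubmx _ 1 1 m)).
  by rewrite row_mxKr linear0 => ->.
pose r := Num.sqrt a.
have r0 : r != 0 by rewrite sqrtr_eq0 -ltNge.
have rr : r * r = a by rewrite -expr2 sqr_sqrtr // ltW.
exists (block_mx (r%:M : 'M[R]_1) 0 (r^-1 *: b^T) B).
rewrite GE (@tr_block_mx _ 1 m 1 m) (@mulmx_block _ 1 m 1 m 1 m).
rewrite !trmx0 !mulmx0 !mul0mx !addr0 tr_scalar_mx -scalar_mxM rr -SE /S.
rewrite linearZ /= trmxK mul_scalar_mx mul_mx_scalar !scalerA divff// !scale1r.
by rewrite -scalemxAl -scalemxAr scalerA -invfM rr addrC subrK.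
Qed.

(** The trace of a square is invariant under change of frame, and for an antisymmetric matrix it is
    minus the sum of the squares of the entries. *)
Lemma skew_trace_sqr_eq0 (R : realType) m (G F : 'M[R]_m) : G^T = G ->
  (forall u : 'rV_m, u != 0 -> 0 < bilin G u u) ->
  F *m G = - (G *m F^T) -> \tr (F *m F) = 0 -> F = 0.
Proof.
move=> Gsym Gpos skewF trF.
have [B GE] := cholesky Gsym Gpos.
have := posdef_unitmx Gpos; rewrite GE unitmx_mul => /andP[uB uBT].
(* In a frame orthonormal for [G] the endomorphism [F] becomes antisymmetric. *)
pose N := invmx B *m F *m B.
have FE : F = B *m N *m invmx B.
  by rewrite /N !mulmxA mulmxV// mul1mx mulmxK.
have NT : N^T = - N.
  apply: (can_inj (mulKmx uB)); apply: (can_inj (mulmxK uBT)).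
  rewrite mulmxN mulNmx /N !mulmxA mulmxV// mul1mx.
  move: skewF; rewrite GE !mulmxA => ->.
  by rewrite opprK !trmx_mul trmx_inv !mulmxA mulmxKV.
have trN : \sum_i \sum_j N i j ^+ 2 = 0.
  transitivity (\tr (N *m N^T)).
    rewrite /mxtrace; apply: eq_bigr => i _; rewrite mxE; apply: eq_bigr => j _.
    by rewrite [N^T _ _]mxE expr2.
  rewrite NT mulmxN linearN /= -[RHS]oppr0 -[in RHS]trF; congr (- _).
  by rewrite [F in RHS]FE !mulmxA mulmxKV// [RHS]mxtrace_mulC !mulmxA mulVmx// mul1mx.
have N0 : N = 0.
  apply/matrixP => i j; rewrite [RHS]mxE; apply/eqP; rewrite -sqrf_eq0; apply/eqP.
  have := @psumr_eq0P _ _ _ _ (fun i _ => sumr_ge0 _ (fun j _ => sqr_ge0 (N i j))) trN.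
  move=> /(_ i isT)/psumr_eq0P -> // k _; exact: sqr_ge0.
by rewrite FE N0 mulmx0 mul0mx.
Qed.

(** * Partial derivatives and smooth components *)

Lemma partial_cst (R : realType) m (i : 'I_m) (c : R) (x : 'rV[R]_m) :
  partial i (fun=> c) x = 0.
Proof. exact: derive_cst. Qed.

Lemma eq_on_partial (R : realType) m (U : set 'rV[R]_m) (i : 'I_m) h k x :
  open U -> U x -> (forall y, U y -> h y = k y) -> partial i h x = partial i k x.
Proof.
move=> Uo Ux hk; apply: near_eq_derive.
by apply: filterS (open_nbhs_nbhs (conj Uo Ux)) => y /hk.
Qed.

Lemma partialN (R : realType) m (i : 'I_m) (h : 'rV[R]_m -> R) x :
  derivable h x (delta_mx 0 i : 'rV[R]_m) ->
  partial i (fun y => - h y) x = - partial i h x.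
Proof. exact: deriveN. Qed.

Lemma partial_sum (R : realType) m (i : 'I_m) n (h : 'I_n -> 'rV[R]_m -> R) x :
  (forall j, derivable (h j) x (delta_mx 0 i : 'rV[R]_m)) ->
  partial i (fun y => \sum_j h j y) x = \sum_j partial i (h j) x.
Proof.
move=> dh; rewrite /partial -derive_sum //; congr ('D_ _ _ _).
by apply/funext => y; rewrite fct_sumE.
Qed.

Lemma partial_sumM (R : realType) m (i : 'I_m) n (h k : 'I_n -> 'rV[R]_m -> R) x :
  (forall j, derivable (h j) x (delta_mx 0 i : 'rV[R]_m)) ->
  (forall j, derivable (k j) x (delta_mx 0 i : 'rV[R]_m)) ->
  partial i (fun y => \sum_j h j y * k j y) x =
  \sum_j (partial i (h j) x * k j x + h j x * partial i (k j) x).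
Proof.
move=> dh dk; rewrite partial_sum => [|j]; last exact: derivableM.
apply: eq_bigr => j _; rewrite /partial (deriveM (dh j) (dk j)) /GRing.scale /=.
by rewrite addrC [in LHS]mulrC.
Qed.

Lemma smooth_derivable (R : realType) m p q (U : set 'rV[R]_m)
    (A : 'rV[R]_m -> 'M[R]_(p, q)) i j k x :
  smooth_mx U A -> U x -> derivable (fun y => A y i j) x (delta_mx 0 k : 'rV[R]_m).
Proof. by move=> /(_ i j 1%N)[_ /(_ k)[+ _]] => /(_ x). Qed.

Lemma smooth_mx_cst (R : realType) m p q (U : set 'rV[R]_m) (A : 'M[R]_(p, q)) :
  smooth_mx U (fun=> A).
Proof.
(* The induction runs over all constants at once, because the partial derivatives replace [c] by
   0. *)
move=> i j k; elim: k (A i j) => [|k IHk] c /=; split=> //;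
  try by move=> x _; exact: cst_continuous.
move=> l; split=> [x _|]; first exact: derivable_cst.
rewrite (_ : partial l _ = fun=> 0); first exact: IHk.
by apply/funext => x; rewrite partial_cst.
Qed.

(** * Brackets, exterior derivative and Lie derivative on coordinate fields *)

Lemma dirder_delta (R : realType) m (i : 'I_m) h (x : 'rV[R]_m) :
  dirder (fun=> delta_mx 0 i) h x = partial i h x.
Proof.
rewrite /dirder (bigD1 i) //= big1 => [|j ji]; rewrite mxE eqxx /=.
  by rewrite eqxx mul1r addr0.
by rewrite (negbTE ji) mul0r.
Qed.

Lemma dirder_cst (R : realType) m X c (x : 'rV[R]_m) : dirder X (fun=> c) x = 0.
Proof. by apply: big1 => i _; rewrite partial_cst mulr0. Qed.

Lemma eq_on_dirder (R : realType) m (U : set 'rV[R]_m) X h k (x : 'rV[R]_m) :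
  open U -> U x -> (forall y, U y -> h y = k y) -> dirder X h x = dirder X k x.
Proof.
by move=> Uo Ux hk; apply: eq_bigr => i _; rewrite (eq_on_partial i Uo Ux hk).
Qed.

Lemma bracket_antisym (R : realType) m X Y (x : 'rV[R]_m) :
  bracket Y X x = - bracket X Y x.
Proof. by apply/rowP => k; rewrite !mxE opprB. Qed.

Lemma bracket_deltar (R : realType) m X (i : 'I_m) (x : 'rV[R]_m) k :
  bracket X (fun=> delta_mx 0 i) x 0 k = - partial i (fun y => X y 0 k) x.
Proof. by rewrite mxE dirder_cst sub0r dirder_delta. Qed.

Lemma form_appN (R : realType) m (w : 'cV[R]_m) u : form_app w (- u) = - form_app w u.
Proof. by rewrite /form_app mulNmx mxE. Qed.

Lemma ext_der_antisym (R : realType) m eta X Y (x : 'rV[R]_m) :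
  ext_der eta Y X x = - ext_der eta X Y x.
Proof.
rewrite /ext_der bracket_antisym form_appN.
ring.
Qed.

Lemma ext_der_delta (R : realType) m eta (i j : 'I_m) (x : 'rV[R]_m) :
  ext_der eta (fun=> delta_mx 0 i) (fun=> delta_mx 0 j) x =
  2^-1 * (partial i (fun y => eta y j 0) x - partial j (fun y => eta y i 0) x).
Proof.
have fa k : (fun y => form_app (eta y) (delta_mx 0 k)) = (fun y => eta y k 0).
  by apply/funext => y; rewrite /form_app -rowE mxE.
rewrite /ext_der !fa !dirder_delta; congr (_ * _).
rewrite (_ : bracket _ _ _ = 0) /form_app ?mul0mx ?mxE ?subr0 //.
by apply/rowP => k; rewrite !mxE !dirder_cst subr0.
Qed.

Lemma lie_metric_delta (R : realType) m xi G (i j : 'I_m) (x : 'rV[R]_m) :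
  lie_metric xi G (fun=> delta_mx 0 i) (fun=> delta_mx 0 j) x =
  \sum_k xi x 0 k * partial k (fun y => G y i j) x
  + \sum_k partial i (fun y => xi y 0 k) x * G x k j
  + \sum_k G x i k * partial j (fun y => xi y 0 k) x.
Proof.
rewrite /lie_metric; congr (_ + _ + _).
- by apply: eq_bigr => k _; congr (_ * partial _ _ _); apply/funext => y; rewrite bilin_delta.
- rewrite bilin_deltar mxE -sumrN; apply: eq_bigr => k _.
  by rewrite bracket_deltar mulNr opprK.
- rewrite /bilin -mulmxA -rowE !mxE -sumrN; apply: eq_bigr => k _.
  by rewrite [_^T _ _]mxE bracket_deltar mulrN opprK.
Qed.

(** * The Levi-Civita connection in coordinates *)

Lemma sum_delta_mx (R : realType) m (i : 'I_m) (c : 'I_m -> R) :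
  \sum_a c a * (delta_mx 0 i : 'rV[R]_m) 0 a = c i.
Proof.
rewrite (bigD1 i) //= big1 => [|a ai]; rewrite mxE eqxx /=.
  by rewrite eqxx mulr1 addr0.
by rewrite (negbTE ai) mulr0.
Qed.

Lemma nabla_delta (R : realType) m G Z (i k : 'I_m) (x : 'rV[R]_m) :
  nabla G (fun=> delta_mx 0 i) Z x 0 k =
  partial i (fun y => Z y 0 k) x + \sum_j christoffel G k i j x * Z x 0 j.
Proof.
rewrite mxE dirder_delta exchange_big /=; congr (_ + _); apply: eq_bigr => j _.
rewrite -[RHS](sum_delta_mx i (fun a => christoffel G k a j x * Z x 0 j)).
by apply: eq_bigr => a _; ring.
Qed.

(** The direction enters only through its value at the point, so covariant derivatives reduce to
    coordinate directions. *)
Lemma nabla_sum (R : realType) m G Y Z (x : 'rV[R]_m) k :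
  nabla G Y Z x 0 k = \sum_i Y x 0 i * nabla G (fun=> delta_mx 0 i) Z x 0 k.
Proof.
under eq_bigr do rewrite nabla_delta mulrDr.
rewrite big_split mxE /=; congr (_ + _); apply: eq_bigr => i _.
by rewrite mulr_sumr; apply: eq_bigr => j _; ring.
Qed.

Lemma eq_on_nabla (R : realType) m (U : set 'rV[R]_m) G X Z Z' x :
  open U -> U x -> (forall y, U y -> Z y = Z' y) -> nabla G X Z x = nabla G X Z' x.
Proof.
move=> Uo Ux ZZ'; apply/rowP => k; rewrite !mxE ZZ' //; congr (_ + _).
by apply: (eq_on_dirder _ Uo Ux) => y Uy; rewrite ZZ'.
Qed.

Lemma nabla0 (R : realType) m G X (x : 'rV[R]_m) : nabla G X (fun=> 0) x = 0.
Proof.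
apply/rowP => k; rewrite [LHS]mxE [RHS]mxE dirder_cst add0r.
by apply: big1 => i _; apply: big1 => j _; rewrite mxE mulr0.
Qed.

(** The Koszul formula for coordinate fields: lowering the upper index cancels the inverse
    metric. *)
Lemma christoffel_lower (R : realType) m (G : 'rV[R]_m -> 'M[R]_m) (i j l : 'I_m) x :
  G x \in unitmx -> (G x)^T = G x ->
  \sum_k christoffel G k i j x * G x k l =
  2^-1 * (partial i (fun y => G y j l) x + partial j (fun y => G y i l) x
          - partial l (fun y => G y i j) x).
Proof.
move=> uG Gsym; pose T : 'cV[R]_m := \col_p (partial i (fun y => G y j p) x
  + partial j (fun y => G y i p) x - partial p (fun y => G y i j) x).
have TE : (G x *m (invmx (G x) *m T)) l 0 = T l 0 by rewrite mulKVmx.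
rewrite [T l 0]mxE [LHS]mxE in TE; rewrite -TE mulr_sumr; apply: eq_bigr => k _.
rewrite -[in LHS]Gsym [_^T _ _]mxE mulrC mulrCA; congr (_ * (_ * _)).
by rewrite mxE; apply: eq_bigr => p _; rewrite [T _ _]mxE.
Qed.

(** Torsion-freeness. Symmetry of [G] is assumed on an open set because it has to be
    differentiated. *)
Lemma christoffel_sym (R : realType) m (U : set 'rV[R]_m) G (k i j : 'I_m) x :
  open U -> U x -> (forall y, U y -> (G y)^T = G y) ->
  christoffel G k i j x = christoffel G k j i x.
Proof.
move=> Uo Ux Gsym; congr (_ * _); apply: eq_bigr => l _; congr (_ * (_ - _)).
  by rewrite addrC.
by apply: (eq_on_partial _ Uo Ux) => y Uy; rewrite -{1}Gsym // mxE.
Qed.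

(** The Killing equation makes g(nabla_X xi, Y) antisymmetric in X and Y, so it equals d eta(X, Y),
    hence g(X, fY) = - g(fX, Y). *)
Lemma nabla_killing_contact (R : realType) m (U : set 'rV[R]_m)
    (G f : 'rV[R]_m -> 'M[R]_m) (xi : 'rV[R]_m -> 'rV[R]_m) (eta : 'rV[R]_m -> 'cV[R]_m) :
  open U -> smooth_mx U G -> smooth_mx U xi ->
  (forall x, U x -> G x \in unitmx) -> (forall x, U x -> (G x)^T = G x) ->
  (forall x, U x -> eta x = (xi x *m G x)^T) ->
  (forall x, U x -> f x *m G x = - (G x *m (f x)^T)) ->
  (forall i j x, U x ->
    lie_metric xi G (fun=> delta_mx 0 i) (fun=> delta_mx 0 j) x = 0) ->
  (forall i j x, U x -> (G x *m (f x)^T) i j =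
    ext_der eta (fun=> delta_mx 0 i) (fun=> delta_mx 0 j) x) ->
  forall Y x, U x -> nabla G Y xi x = - (Y x *m f x).
Proof.
move=> Uo sG sxi uG Gsym etaE skewf kil con Y x Ux.
have dG i j k := @smooth_derivable _ _ _ _ _ _ i j k _ sG Ux.
have dxi i k := @smooth_derivable _ _ _ _ _ _ 0 i k _ sxi Ux.
have deta i l : partial i (fun y => eta y l 0) x =
    \sum_k (partial i (fun y => xi y 0 k) x * G x k l
            + xi x 0 k * partial i (fun y => G y k l) x).
  rewrite -partial_sumM // ; apply: (eq_on_partial _ Uo Ux) => y Uy.
  by rewrite etaE // !mxE.
(* Row i of [K] is the derivative of [xi] in the i-th coordinate direction. *)
pose K : 'M[R]_m := \matrix_(i, k) nabla G (fun=> delta_mx 0 i) xi x 0 k.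
suff KE : K = - f x.
  apply/rowP => k; rewrite nabla_sum -mulmxN -KE mxE.
  by apply: eq_bigr => i _; rewrite [K _ _]mxE.
apply: (can_inj (mulmxK (uG x Ux))); rewrite mulNmx skewf // opprK.
(* Half the sum of the Killing equation and of the formula for [d eta] is the
   Koszul formula for the covariant derivative of [xi]. *)
apply/matrixP => i l; rewrite con // ext_der_delta !deta !big_split /=.
have := kil i l x Ux; rewrite lie_metric_delta => {}kil.
have KGE : (K *m G x) i l = \sum_k partial i (fun y => xi y 0 k) x * G x k l
    + 2^-1 * (\sum_j xi x 0 j * partial i (fun y => G y j l) x
              + \sum_j xi x 0 j * partial j (fun y => G y i l) x
              - \sum_j xi x 0 j * partial l (fun y => G y i j) x).
  rewrite mxE; under eq_bigr do rewrite [K _ _]mxE nabla_delta mulrDl mulr_suml.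
  rewrite big_split /=; congr (_ + _); rewrite exchange_big /=.
  rewrite -big_split -sumrB mulr_sumr /=; apply: eq_bigr => j _.
  rewrite -mulrDr -mulrBr mulrCA -christoffel_lower ?uG ?Gsym // mulr_sumr.
  by apply: eq_bigr => k _; ring.
have symc : \sum_k G x i k * partial l (fun y => xi y 0 k) x =
    \sum_k partial l (fun y => xi y 0 k) x * G x k i.
  by apply: eq_bigr => k _; rewrite mulrC -{1}Gsym // mxE.
have symd : \sum_k xi x 0 k * partial l (fun y => G y i k) x =
    \sum_k xi x 0 k * partial l (fun y => G y k i) x.
  apply: eq_bigr => k _; congr (_ * _).
  by apply: (eq_on_partial _ Uo Ux) => y Uy; rewrite -{1}Gsym // mxE.
(* With the sums taken as unknowns, the goal is half of the Killing equation [kil]. *)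
rewrite KGE symd; rewrite symc in kil; lra.
Qed.

(** * Ricci curvature of characteristic fields *)

(** Curvature sees its last argument only through covariant derivatives. This allows one
    characteristic field to be exchanged for another. *)
Lemma eq_on_ricci (R : realType) m (U : set 'rV[R]_m) G Y Z Z' (x : 'rV[R]_m) :
  open U -> U x ->
  (forall X y, U y -> nabla G X Z y = nabla G X Z' y) ->
  ricci G Y Z x = ricci G Y Z' x.
Proof.
move=> Uo Ux ZZ'; apply: eq_bigr => i _; rewrite /curvature.
congr (fun_of_matrix _ _ _); rewrite ZZ' //; congr (_ - _ - _);
  apply: (eq_on_nabla _ _ Uo Ux) => y Uy; exact: ZZ'.
Qed.

(** Since nabla_xi xi = - f xi = 0, only - nabla_xi (nabla_{e_i} xi) and f [e_i, xi] remain in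
    R(e_i, xi) xi. Their trace is that of nabla_xi f minus that of f^2. *)
Lemma ricci_characteristic (R : realType) m (U : set 'rV[R]_m)
    (G f : 'rV[R]_m -> 'M[R]_m) (xi : 'rV[R]_m -> 'rV[R]_m) x :
  open U -> smooth_mx U f -> (forall y, U y -> (G y)^T = G y) ->
  (forall Y y, U y -> nabla G Y xi y = - (Y y *m f y)) ->
  (forall y, U y -> xi y *m f y = 0) -> (forall y, U y -> \tr (f y) = 0) ->
  U x -> ricci G xi xi x = - \tr (f x *m f x).
Proof.
move=> Uo sf Gsym nxi fxi trf Ux.
have df i j k := @smooth_derivable _ _ _ _ _ _ i j k _ sf Ux.
(* The formula for the covariant derivative of [xi], solved for its partial derivatives. *)
have dxi i k : partial i (fun y => xi y 0 k) x =
    - f x i k - \sum_j christoffel G k i j x * xi x 0 j.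
  apply/eqP; rewrite -subr_eq opprK -nabla_delta nxi //.
  by rewrite mxE -rowE mxE.
have RE i : curvature G (fun=> delta_mx 0 i) xi xi x 0 i =
    \sum_a xi x 0 a * partial a (fun y => f y i i) x
    + \sum_k \sum_j christoffel G i j k x * xi x 0 j * f x i k
    - (f x *m f x) i i
    - \sum_k \sum_j christoffel G k i j x * xi x 0 j * f x k i.
  have rVB (u v : 'rV[R]_m) : (u - v) 0 i = u 0 i - v 0 i by rewrite !mxE.
  have rVN (u : 'rV[R]_m) : (- u) 0 i = - u 0 i by rewrite mxE.
  rewrite /curvature !rVB nxi // rVN opprK.
  rewrite (@eq_on_nabla _ _ _ _ _ _ (fun=> 0) _ Uo Ux); last first.
    by move=> y Uy; rewrite nxi // fxi // oppr0.
  rewrite nabla0 (mxE _ _ 0 i) add0r.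
  rewrite (@eq_on_nabla _ _ _ _ _ _ (fun y => - row i (f y)) _ Uo Ux); last first.
    by move=> y Uy; rewrite nxi // -rowE.
  have -> : (bracket (fun=> delta_mx 0 i) xi x *m f x) 0 i =
      - (f x *m f x) i i - \sum_k \sum_j christoffel G k i j x * xi x 0 j * f x k i.
    rewrite !mxE -!sumrN -big_split /=; apply: eq_bigr => k _.
    by rewrite bracket_antisym mxE bracket_deltar opprK dxi mulrBl mulNr mulr_suml.
  rewrite addrA; congr (_ - _ - _).
  rewrite mxE opprD -!sumrN; congr (_ + _).
    apply: eq_bigr => a _.
    rewrite (_ : (fun y => (- row i (f y)) 0 i) = fun y => - f y i i).
      by rewrite partialN // mulrN opprK.
    by apply/funext => y; rewrite !mxE.
  rewrite [RHS]exchange_big; apply: eq_bigr => j _; rewrite -sumrN.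
  by apply: eq_bigr => k _; rewrite !mxE mulrN opprK.
rewrite /ricci (eq_bigr _ (fun i _ => RE i)) !sumrB big_split /= -!/(mxtrace _).
have -> : \sum_i \sum_a xi x 0 a * partial a (fun y => f y i i) x = 0.
  rewrite exchange_big big1 // => a _; rewrite -mulr_sumr -partial_sum //.
  by rewrite (eq_on_partial _ Uo Ux trf) partial_cst mulr0.
(* The Christoffel terms of the trace of nabla_xi f cancel: exchanging the indices contracted with
   [f] leaves a difference of the two lower indices only. *)
rewrite [X in _ + X - _ - _]exchange_big /= add0r addrAC.
rewrite (_ : \sum_j _ = \sum_i \sum_k \sum_j christoffel G k i j x * xi x 0 j * f x k i).
  by rewrite subrr add0r.
apply: eq_bigr => i _; apply: eq_bigr => k _; apply: eq_bigr => j _.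
by rewrite (christoffel_sym _ _ _ Uo Ux Gsym).
Qed.

(** * Weak f-K-contact structures: from the contact and Killing conditions to the contradiction *)

Theorem corollary5p1 (R : realType) (n s : nat)
  (M : smooth_manifold R (2 * n + s)) (S : weak_metric_f_structure M) :
  (1 <= n)%N -> (1 < s)%N -> weak_f_K_contact S -> ~ einstein (wg S).
Proof.
move=> n_gt0 s_gt1 [contact kill] [lambda ric].
(* The contradiction arises at one point, but the identities are proved on a whole chart image so
   that they can be differentiated. *)
have [p _] := manifold_nonempty M.
have [a pa] := atlas_cover p.
pose x := chart_map (atlas a) p.
have Ux : img a x by exists p.
have Uo : open (img a) by exact: chart_img_open.
pose G := wg S a; pose f := wf S a; pose xi i := wxi S i a; pose eta i := weta S i a.
pose i0 : 'I_s := Ordinal (ltnW s_gt1); pose i1 : 'I_s := Ordinal s_gt1.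
have Gpos y : img a y -> forall u : 'rV_(2 * n + s), u != 0 -> 0 < bilin (G y) u u.
  by move=> Uy; exact: rm_pos.
have uG y (Uy : img a y) : G y \in unitmx := posdef_unitmx (Gpos y Uy).
have Gsym y : img a y -> (G y)^T = G y.
  move=> Uy; apply/matrixP => i j.
  by rewrite mxE -!bilin_delta; exact: rm_sym.
have con k i j y : img a y -> (G y *m (f y)^T) i j =
    ext_der (eta k) (fun=> delta_mx 0 i) (fun=> delta_mx 0 j) y.
  move=> Uy; rewrite -(contact k a _ _ _ _ y Uy); last 2 first.
  - exact: smooth_mx_cst.
  - exact: smooth_mx_cst.
  rewrite /fundamental_form /bilin trmx_mul trmx_delta !mulmxA -colE [RHS]mxE.
  by rewrite -mulmxA -rowE [RHS]mxE.
(* Skewness of f is the antisymmetry of d eta. *)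
have skewf y : img a y -> f y *m G y = - (G y *m (f y)^T).
  move=> Uy; rewrite -[G y in LHS]Gsym // -[f y in LHS]trmxK -trmx_mul.
  apply/matrixP => i j; rewrite mxE (con i0) // ext_der_antisym -(con i0) //.
  by rewrite [RHS]mxE.
(* By skewness f is conjugate to minus its transpose, so its trace is its own opposite. *)
have trf y : img a y -> \tr (f y) = 0.
  move=> Uy; have fE : f y = - (G y *m (f y)^T *m invmx (G y)).
    by rewrite -mulNmx -skewf // mulmxK // uG.
  have : \tr (f y) = - \tr (f y).
    by rewrite [in LHS]fE linearN /= mxtrace_mulC mulmxA mulVmx ?uG // mul1mx mxtrace_tr.
  by move=> /eqP; rewrite eq_sym eqNr => /eqP.
have xi_eta y k : img a y -> xi k y *m (\sum_(i < s) eta i y *m xi i y) = xi k y.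
  move=> Uy; rewrite mulmx_sumr (bigD1 k) //= big1 => [|i ik]; rewrite mulmxA.
    rewrite (mx11_scalar (_ *m _)) mul_scalar_mx addr0.
    by have := weta_xi S Uy k k; rewrite /form_app eqxx => ->; rewrite scale1r.
  rewrite (mx11_scalar (_ *m _)) mul_scalar_mx.
  have := weta_xi S Uy i k; rewrite /form_app (negbTE ik) => ->.
  by rewrite scale0r.
(* Here f^2 xi_k = - Q xi_k + xi_k = 0, so g(f xi_k, f xi_k) = - g(f^2 xi_k, xi_k) = 0, and [G] is
   positive definite. *)
have fxi k y : img a y -> xi k y *m f y = 0.
  move=> Uy; apply/eqP; apply: contraT => /(Gpos y Uy).
  have ffxi : xi k y *m f y *m f y = 0.
    rewrite -mulmxA (wf_square S Uy) mulmxDr xi_eta // mulmxN (wQ_xi S Uy).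
    by rewrite addNr.
  have skewf' : G y *m (f y)^T = - (f y *m G y) by rewrite skewf // opprK.
  rewrite /bilin trmx_mul mulmxA -(mulmxA _ (G y)) skewf' mulmxN mulNmx !mulmxA.
  by rewrite ffxi !mul0mx oppr0 mxE ltxx.
(* Compatibility of the metric with xi_k as second argument reads 0 = g(X, xi_k) - eta^k(X). *)
have etaE k y : img a y -> eta k y = (xi k y *m G y)^T.
  move=> Uy; apply/matrixP => j l; rewrite ord1 [RHS]mxE -bilin_deltar.
  rewrite [RHS](rm_sym (wg S) Uy).
  have := wg_compatible S Uy (delta_mx 0 j) (xi k y).
  rewrite (fxi k y Uy) (wQ_xi S Uy) {1}/bilin trmx0 mulmx0 mxE => /esym/eqP.
  rewrite subr_eq0 => /eqP ->; rewrite (bigD1 k) //= big1 => [|i ik].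
    by rewrite addr0 (weta_xi S Uy) eqxx mulr1 /form_app -rowE mxE.
  by rewrite (weta_xi S Uy) (negbTE ik) mulr0.
have xixi k l y : img a y -> bilin (G y) (xi k y) (xi l y) = (k == l)%:R.
  move=> Uy; rewrite -(weta_xi S Uy k l) /form_app -/(eta k y) etaE //.
  by rewrite trmx_mul Gsym // mulmxA (rm_sym (wg S) Uy).
have nxi k Y y : img a y -> nabla G Y (xi k) y = - (Y y *m f y).
  apply: (@nabla_killing_contact _ _ (img a) _ _ _ (eta k)) => //.
  - exact: rm_smooth.
  - exact: vf_smooth.
  - by move=> z; exact: etaE.
  - by move=> i j z Uz; apply: (kill k a) => //; exact: smooth_mx_cst.
  - exact: con.
have ricE k l y : img a y -> ricci G (xi k) (xi l) y = lambda * (k == l)%:R.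
  move=> Uy; rewrite -(xixi k l y Uy).
  by apply: ric => //; exact: vf_smooth.
have lambda0 : lambda = 0.
  have := ricE i0 i0 x Ux; rewrite eqxx mulr1 => <-.
  (* The assumption [1 < s] acts here: replacing [xi i0] by [xi i1] keeps the Ricci value and turns
     the Kronecker delta into 0. *)
  rewrite (@eq_on_ricci _ _ (img a) _ _ _ (xi i1)) // ?ricE ?mulr0 //.
  by move=> X y Uy; rewrite !nxi.
have f0 : f x = 0.
  apply: (skew_trace_sqr_eq0 (Gsym x Ux) (Gpos x Ux) (skewf x Ux)).
  apply/eqP; rewrite -oppr_eq0 -(@ricci_characteristic _ _ (img a) G f (xi i0)) //.
  - by rewrite ricE // lambda0 mul0r.
  - exact: ef_smooth.
  - by move=> Y y; exact: nxi.
  - by move=> y; exact: fxi.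
have QE : wQ S a x = \sum_(i < s) eta i x *m xi i x.
  have := wf_square S Ux; rewrite -/f f0 mul0mx => /esym/eqP.
  by rewrite addrC subr_eq0 => /eqP.
have : (\rank (wQ S a x) <= s)%N.
  (* Q factors through R^s, with the eta^i as columns and the xi_i as rows. *)
  rewrite (_ : wQ S a x = (\matrix_(j < (2 * n + s)%N, i < s) eta i x j 0)
                          *m (\matrix_(i < s) xi i x)).
    exact: mulmx_max_rank.
  rewrite QE; apply/matrixP => j l; rewrite summxE mxE; apply: eq_bigr => i _.
  by rewrite !mxE big_ord1.
rewrite mxrank_unit ?(wQ_nonsingular S Ux) // -[X in (_ <= X)%N]add0n leq_add2r.
by rewrite leqn0 muln_eq0 /= -leqn0 leqNgt n_gt0.
Qed.
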